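(* Let $N\in\mathbb N^+$ and let $T=\{t_k:k\in\mathbb N\}\subset[0,\infty)$ be an infinite locally finite set, enumerated increasingly. Put $Q_{T,N}(r)=\sum_{k\ge0}|r^{t_k}-r^{Nk}|^2$ for $0<r<1$ and $q^*(T,N)=\limsup_{r\uparrow1}Q_{T,N}(r)$. If $$D_\infty=\limsup_{k\to\infty}\frac{|t_k-Nk|}{\sqrt k}<\infty,$$ then $$q^*(T,N)\le\frac{D_\infty^2}{4N^2}.$$ If $(t_k-Nk)/\sqrt k\to d$ as $k\to\infty$ (for some real $d$), then $\lim_{r\uparrow1}Q_{T,N}(r)=\dfrac{d^2}{4N^2}$.
   Context: $\mathbb N=\{0,1,2,\dots\}$, $\mathbb N^+=\{1,2,\dots\}$. A set $T\subset[0,\infty)$ is locally finite if $T\cap[0,R]$ is finite for every $R>0$; ''enumerated increasingly'' means $0\le t_0<t_1<\cdots$. *)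

(* Defs.v *)
From mathcomp Require Import all_boot all_order all_algebra.
From mathcomp Require Import all_classical all_reals all_analysis.

Set Implicit Arguments.
Unset Strict Implicit.
Unset Printing Implicit Defensive.

Import Order.TTheory GRing.Theory Num.Theory.
Import numFieldNormedType.Exports.

Local Open Scope classical_set_scope.
Local Open Scope ring_scope.

Definition locally_finite_set (R : realType) (T : set R) : Prop :=
  forall M : R, 0 < M -> finite_set (T `&` `[0, M]).

Definition increasing_enumeration (R : realType) (T : set R) (t : nat -> R)
  : Prop :=
  T = range t /\ {homo t : i j / (i < j)%N >-> i < j}.

(* The sums below are taken in the extended reals, so that a divergent series
   has value +oo.  The function is only meant for 0 < r < 1, which is all that
   the filter 1^'- sees. *)
Definition Qsum (R : realType) (t : nat -> R) (N : nat) (r : R) : \bar R :=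
  (\sum_(0 <= k <oo) ((`|r `^ (t k) - r ^+ (N * k)| ^+ 2)%:E))%E.

Definition qstar (R : realType) (t : nat -> R) (N : nat) : \bar R :=
  limf_esup (Qsum t N) (1 : R)^'-.

(* At k = 0 the quotient is 0 by the convention x / 0 = 0; this does not affect
   limits. *)
Definition deviation (R : realType) (t : nat -> R) (N k : nat) : R :=
  (t k - (N * k)%:R) / Num.sqrt k%:R.

Definition Dinfty (R : realType) (t : nat -> R) (N : nat) : \bar R :=
  limn_esup (fun k => (`|t k - (N * k)%:R| / Num.sqrt k%:R)%:E).

(* Main.v *)
(* Put s = - ln r and a = N, so that the k-th term is (e^(-s t_k) - e^(-s a k))^2.
   Since |u| e^(-|u|) <= |e^u - 1| <= |u| e^|u|, and |t_k - a k| <= eta a k for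
   large k, that term lies between s^2 (t_k - a k)^2 e^(- 2 s a k (1 +- eta)).
   When (t_k - a k)^2 is compared with a multiple of k, the tail is compared
   with s^2 * sum_k k x^k = s^2 x / (1 - x)^2 at x = e^(- 2 s a (1 +- eta)), which
   tends to 1 / (2 a (1 +- eta))^2 as s -> 0+, while any finite part of the sum
   vanishes in the limit.  Finally let eta -> 0. *)
Require Import Defs.
From mathcomp Require Import all_boot all_order all_algebra.
From mathcomp Require Import all_classical all_reals all_analysis.
From mathcomp Require Import ring lra.

Import Order.TTheory GRing.Theory Num.Theory.
Import numFieldNormedType.Exports.

Local Open Scope classical_set_scope.
Local Open Scope ring_scope.

(** * Two-sided bounds for [e^u - 1] *)

Lemma normr_expR_sub1_le (R : realType) (u : R) :
  `|expR u - 1| <= `|u| * expR `|u|.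
Proof.
have e0 := expR_gt0 u.
have [u0|u0] := ger0P u.
  have h := expR_ge1Dx (- u).
  have e1 : expR u * expR (- u) = 1 by rewrite -expRD subrr expR0.
  have e2 : 1 <= expR u by rewrite -expR0 ler_expR.
  (* Multiplying [1 - u <= e^(-u)] by [e^u] gives [e^u (1 - u) <= 1], which rearranges to the claim.
     For [u < 0] the chain is [1 - e^u <= -u <= -u e^(-u)]. *)
  have : expR u * (1 - u) <= expR u * expR (- u) by rewrite ler_pM2l.
  rewrite e1 ger0_norm ?subr_ge0 //; lra.
have h := expR_ge1Dx u.
have e2 : 1 <= expR (- u) by rewrite -expR0 ler_expR; lra.
have e3 : expR u <= 1 by rewrite -expR0 ler_expR; lra.
rewrite ler0_norm ?subr_le0 //; nra.
Qed.

Lemma normr_expR_sub1_ge (R : realType) (u : R) :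
  `|u| * expR (- `|u|) <= `|expR u - 1|.
Proof.
have e0 := expR_gt0 u.
have [u0|u0] := ger0P u.
  have h := expR_ge1Dx u.
  have e2 : expR (- u) <= 1 by rewrite -expR0 ler_expR; lra.
  have e3 := expR_gt0 (- u).
  rewrite ger0_norm; first nra.
  by rewrite subr_ge0 -expR0 ler_expR.
have h := expR_ge1Dx (- u).
have e1 : expR u * expR (- u) = 1 by rewrite -expRD subrr expR0.
have e3 : expR u <= 1 by rewrite -expR0 ler_expR; lra.
have : expR u * (1 - u) <= expR u * expR (- u) by rewrite ler_pM2l.
rewrite e1 opprK ler0_norm ?subr_le0 //; lra.
Qed.

(** * The series of [k x^k] and its value at [x = e^(-y)] *)

Lemma sum_natr_geometric (R : comNzRingType) (x : R) (n : nat) :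
  (1 - x) ^+ 2 * \sum_(0 <= k < n.+1) (k%:R * x ^+ k) =
  x - n.+1%:R * x ^+ n.+1 + n%:R * x ^+ n.+2.
Proof.
elim: n => [|n IH]; first by rewrite big_nat1; ring.
by rewrite big_nat_recr //= mulrDr IH !exprS -!natr1; ring.
Qed.

(** The closed form of the partial sums reduces the claim to [k x^k --> 0]. The same closed form
    bounds the partial sums, so the series converges and its terms tend to 0. *)
Lemma cvg_sum_natr_geometric (R : realType) (x : R) : 0 < x < 1 ->
  \sum_(0 <= k < n) (k%:R * x ^+ k) @[n --> \oo] --> x / (1 - x) ^+ 2.
Proof.
move=> /andP[x0 x1].
have d0 : 0 < (1 - x) ^+ 2 by rewrite exprn_gt0 // subr_gt0.
pose u : R ^nat := fun k => k%:R * x ^+ k.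
have u0 k : 0 <= u k by rewrite mulr_ge0 // exprn_ge0 // ltW.
have shiftE n : (1 - x) ^+ 2 * series u n.+1 = x - (u n.+1 - x * u n * x).
  by rewrite /series /= sum_natr_geometric /u !exprS; ring.
have cu : u n @[n --> \oo] --> 0.
  apply: cvg_series_cvg_0; apply: nondecreasing_is_cvgn.
    by apply/nondecreasing_seqP => n; rewrite /series /= big_nat_recr //= lerDl.
  exists (x / (1 - x) ^+ 2) => _ [n _ <-].
  apply: (@le_trans _ _ (series u n.+1)).
    by rewrite /series /= big_nat_recr //= lerDl.
  rewrite ler_pdivlMr // mulrC shiftE lerBlDr lerDl.
  (* The correction term is nonnegative in this form, so partial sums stay below [x / (1 - x)^2]. *)
  have -> : u n.+1 - x * u n * x = x ^+ n.+1 * (1 + n%:R * (1 - x)).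
    by rewrite /u exprS -natr1; ring.
  by rewrite mulr_ge0 ?addr_ge0 ?mulr_ge0 ?exprn_ge0 ?subr_ge0 // ltW.
rewrite -(cvg_shiftS _).
have -> : (fun n => \sum_(0 <= k < n.+1) (k%:R * x ^+ k)) =
    (fun n => (x - (u n.+1 - x * u n * x)) / (1 - x) ^+ 2).
  by apply/funext => n; rewrite -shiftE mulrC mulKf // gt_eqF.
apply: cvgMl.
rewrite [X in _ --> X](_ : x = x - (0 - x * 0 * x)); last by ring.
apply: cvgB; first exact: cvg_cst.
apply: cvgB; first by rewrite (cvg_shiftS u).
by apply: cvgMl; apply: cvgMr.
Qed.

(** Both bounds come from [y e^(-y) <= 1 - e^(-y) <= y], that is, from [1 + v <= e^v] at [v = y] and
    [v = -y]. *)
Lemma expR_quotient_bounds (R : realType) (y : R) : 0 < y ->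
  expR (- y) / y ^+ 2 <= expR (- y) / (1 - expR (- y)) ^+ 2 <= expR y / y ^+ 2.
Proof.
move=> y0.
have x0 := expR_gt0 (- y).
have x1 : expR (- y) < 1 by rewrite -[ltRHS]expR0 ltr_expR oppr_lt0.
have h1 := expR_ge1Dx (- y).
have h2 := expR_ge1Dx y.
have e1 : expR y * expR (- y) = 1 by rewrite -expRD subrr expR0.
have e0 := expR_gt0 y.
set x := expR (- y) in x0 x1 h1 e1 *.
have d0 : 0 < (1 - x) ^+ 2 by rewrite exprn_gt0 // subr_gt0.
have d1 : 0 < y ^+ 2 by rewrite exprn_gt0.
have h3 : y * x <= 1 - x by nra.
have h4 : (y * x) ^+ 2 <= (1 - x) ^+ 2.
  by rewrite ler_pXn2r // nnegrE; nra.
apply/andP; split.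
  rewrite ler_pM2l // lef_pV2 ?posrE // ler_pXn2r // ?nnegrE; lra.
rewrite ler_pdivrMr // mulrAC ler_pdivlMr //.
have -> : x * y ^+ 2 = expR y * (y * x) ^+ 2.
  by rewrite -[LHS]mul1r -e1; ring.
by rewrite ler_pM2l.
Qed.

(** * The sum at [r = e^(-s)], with a real slope [a] in place of [N]: bounds for fixed [s] *)

Definition sqdiff_exp {R : realType} (t : nat -> R) (a s : R) (k : nat) : R :=
  (expR (- (s * t k)) - expR (- (s * (a * k%:R)))) ^+ 2.

Definition expsum {R : realType} (t : nat -> R) (a s : R) : \bar R :=
  (\sum_(0 <= k <oo) (sqdiff_exp t a s k)%:E)%E.

Lemma sqdiff_exp_ge0 (R : realType) (t : nat -> R) (a s : R) (k : nat) :
  0 <= sqdiff_exp t a s k.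
Proof. exact: sqr_ge0. Qed.

(** Factoring out [e^(-s v)] leaves [e^u - 1] with [u = -s (t - v)] and [|u| <= s eta v]. The error
    factors [e^(-|u|)] and [e^|u|], once squared, change the exponent [-2 s v] by at most the
    factors [1 + eta] and [1 - eta]. *)
Lemma sqr_expR_sub_bounds (R : realType) (s t v eta : R) :
  0 <= s -> `|t - v| <= eta * v ->
  (s * (t - v)) ^+ 2 * expR (- (2 * s * v * (1 + eta)))
    <= (expR (- (s * t)) - expR (- (s * v))) ^+ 2
    <= (s * (t - v)) ^+ 2 * expR (- (2 * s * v * (1 - eta))).
Proof.
move=> s0 tv.
pose u := - (s * (t - v)).
have uE : `|u| = s * `|t - v| by rewrite /u normrN normrM ger0_norm.
have ule : `|u| <= s * (eta * v) by rewrite uE ler_wpM2l.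
have -> : expR (- (s * t)) - expR (- (s * v)) = expR (- (s * v)) * (expR u - 1).
  by rewrite mulrBr mulr1 -expRD; congr (expR _ - _); rewrite /u; ring.
have -> : (s * (t - v)) ^+ 2 = `|u| ^+ 2 by rewrite real_normK ?num_real// sqrrN.
rewrite exprMn -(real_normK (num_real (expR u - 1))).
have sq (w : R) : expR w ^+ 2 = expR (2 * w) by rewrite expRM_natl.
apply/andP; split.
  rewrite [leLHS]mulrC.
  have -> : - (2 * s * v * (1 + eta)) = 2 * - (s * v) + 2 * - (s * (eta * v)).
    by ring.
  rewrite expRD -!sq -mulrA.
  apply: ler_wpM2l; rewrite ?exprn_ge0 ?expR_ge0 // -exprMn.
  rewrite ler_pXn2r // ?nnegrE ?mulr_ge0 ?expR_ge0 // mulrC.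
  apply: le_trans (normr_expR_sub1_ge _ _).
  by rewrite ler_wpM2l // ler_expR lerN2.
rewrite [leRHS]mulrC.
have -> : - (2 * s * v * (1 - eta)) = 2 * - (s * v) + 2 * (s * (eta * v)).
  by ring.
rewrite expRD -!sq -[leRHS]mulrA.
apply: ler_wpM2l; rewrite ?exprn_ge0 ?expR_ge0 // -exprMn.
rewrite ler_pXn2r // ?nnegrE ?mulr_ge0 ?expR_ge0 // [leRHS]mulrC.
apply: le_trans (normr_expR_sub1_le _ _) _.
by rewrite ler_wpM2l // ler_expR.
Qed.

(** The head is kept exactly and only the tail is estimated, so that for fixed [K] and [eta] the
    bound has an evident limit as [s] tends to 0. *)
Lemma expsum_le (R : realType) (t : nat -> R) (a s eta B : R) (K : nat) :
  0 < s -> 0 < a -> 0 < eta < 1 -> 0 <= B ->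
  (forall k, (K <= k)%N -> (t k - a * k%:R) ^+ 2 <= B * k%:R) ->
  (forall k, (K <= k)%N -> `|t k - a * k%:R| <= eta * (a * k%:R)) ->
  (expsum t a s <= (\sum_(0 <= k < K) sqdiff_exp t a s k +
    B / (2 * a * (1 - eta)) ^+ 2 * expR (s * (2 * a * (1 - eta))))%:E)%E.
Proof.
move=> s0 a0 /andP[eta0 eta1] B0 tB teta.
pose c := 2 * a * (1 - eta).
have c0 : 0 < c by rewrite !mulr_gt0 // subr_gt0.
have y0 : 0 < c * s by rewrite mulr_gt0.
pose x := expR (- (c * s)).
have x0 : 0 < x by rewrite expR_gt0.
have x1 : x < 1 by rewrite -[ltRHS]expR0 ltr_expR oppr_lt0.
have h0 k : (0 <= (sqdiff_exp t a s k)%:E)%E by rewrite lee_fin sqdiff_exp_ge0.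
have xk k : 0 <= k%:R * x ^+ k by rewrite mulr_ge0 // exprn_ge0 // ltW.
rewrite /expsum (nneseries_split 0 K); last by move=> k _; exact: h0.
rewrite add0n sumEFin EFinD leeD2l //.
apply: lime_le; first exact: is_cvg_nneseries.
apply: nearW => n; rewrite sumEFin lee_fin.
have term k : (K <= k)%N ->
    sqdiff_exp t a s k <= s ^+ 2 * B * (k%:R * x ^+ k).
  move=> Kk.
  have /andP[_] := sqr_expR_sub_bounds _ _ _ _ _ (ltW s0) (teta k Kk).
  move/le_trans; apply.
  have -> : - (2 * s * (a * k%:R) * (1 - eta)) = - (c * s) * k%:R.
    by rewrite /c; ring.
  rewrite expRM_natr -/x exprMn.
  rewrite [leRHS]mulrA; apply: ler_wpM2r; first by rewrite exprn_ge0 // ltW.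
  rewrite -[leRHS]mulrA; apply: ler_wpM2l; first exact: sqr_ge0.
  exact: tB.
(* The comparison sum is enlarged to start at 0, where the closed form applies; if [n <= K] the tail
   is empty. *)
apply: (@le_trans _ _ (\sum_(0 <= k < n) s ^+ 2 * B * (k%:R * x ^+ k))).
  have [nK|Kn] := leqP n K.
    rewrite big_geq // sumr_ge0 // => k _.
    by rewrite !mulr_ge0 // ?exprn_ge0 // ltW.
  rewrite (@big_cat_nat _ _ _ K 0 n) //=; last exact: ltnW.
  rewrite -[leLHS]add0r lerD //.
    by rewrite sumr_ge0 // => k _; rewrite !mulr_ge0 // ?exprn_ge0 // ltW.
  by rewrite ler_sum_nat // => k /andP[Kk _]; exact: term.
rewrite -mulr_sumr.
have x01 : 0 < x < 1 by rewrite x0.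
have S_le : \sum_(0 <= k < n) (k%:R * x ^+ k) <= x / (1 - x) ^+ 2.
  have cS := cvg_sum_natr_geometric _ _ x01.
  rewrite -(cvg_lim (@Rhausdorff R) cS).
  apply: (@nondecreasing_cvgn_le _ (fun n => \sum_(0 <= k < n) (k%:R * x ^+ k))).
    by apply/nondecreasing_seqP => m; rewrite big_nat_recr //= lerDl.
  by apply/cvg_ex; exists (x / (1 - x) ^+ 2).
have /andP[_ y_le] := expR_quotient_bounds _ _ y0.
(* Here [s^2] cancels against [(c s)^2], leaving [B / c^2]. *)
apply: (@le_trans _ _ (s ^+ 2 * B * (expR (c * s) / (c * s) ^+ 2))).
  by apply: ler_wpM2l; [rewrite mulr_ge0 ?sqr_ge0|exact: le_trans S_le y_le].
rewrite le_eqVlt; apply/orP; left; apply/eqP.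
by rewrite -/c [s * c]mulrC; field; rewrite !gt_eqF.
Qed.

(** Dropping the head of the series of [k x^k] costs at most the sum of [k] below [K], since
    [x <= 1]; the prefactor [s^2] makes this loss vanish in the limit. *)
Lemma expsum_ge (R : realType) (t : nat -> R) (a s eta A : R) (K : nat) :
  0 < s -> 0 < a -> 0 < eta -> 0 <= A ->
  (forall k, (K <= k)%N -> A * k%:R <= (t k - a * k%:R) ^+ 2) ->
  (forall k, (K <= k)%N -> `|t k - a * k%:R| <= eta * (a * k%:R)) ->
  ((A / (2 * a * (1 + eta)) ^+ 2 * expR (s * - (2 * a * (1 + eta))) -
     s ^+ 2 * A * \sum_(0 <= k < K) k%:R)%:E <= expsum t a s)%E.
Proof.
move=> s0 a0 eta0 A0 tA teta.
pose c := 2 * a * (1 + eta).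
have c0 : 0 < c by rewrite !mulr_gt0 // addr_gt0.
have y0 : 0 < c * s by rewrite mulr_gt0.
pose x := expR (- (c * s)).
have x0 : 0 < x by rewrite expR_gt0.
have x1 : x < 1 by rewrite -[ltRHS]expR0 ltr_expR oppr_lt0.
have x01 : 0 < x < 1 by rewrite x0.
have sA0 : 0 <= s ^+ 2 * A by rewrite mulr_ge0 ?sqr_ge0.
have h0 k : (0 <= (sqdiff_exp t a s k)%:E)%E by rewrite lee_fin sqdiff_exp_ge0.
have term k : (K <= k)%N ->
    s ^+ 2 * A * (k%:R * x ^+ k) <= sqdiff_exp t a s k.
  move=> Kk.
  have /andP[+ _] := sqr_expR_sub_bounds _ _ _ _ _ (ltW s0) (teta k Kk).
  apply: le_trans.
  have -> : - (2 * s * (a * k%:R) * (1 + eta)) = - (c * s) * k%:R.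
    by rewrite /c; ring.
  rewrite expRM_natr -/x exprMn.
  rewrite [leLHS]mulrA; apply: ler_wpM2r; first by rewrite exprn_ge0 // ltW.
  rewrite -[leLHS]mulrA; apply: ler_wpM2l; first exact: sqr_ge0.
  exact: tA.
pose S n := \sum_(0 <= k < n) (k%:R * x ^+ k).
have SK : S K <= \sum_(0 <= k < K) k%:R.
  rewrite ler_sum // => k _; rewrite ler_piMr // exprn_ile1 // ltW //.
have partial n : (K <= n)%N -> ((s ^+ 2 * A * (S n - S K))%:E <= expsum t a s)%E.
  move=> Kn; apply: le_trans (nneseries_lim_ge n _); last by move=> k _ _; exact: h0.
  rewrite sumEFin lee_fin (@big_cat_nat _ _ _ K 0 n) //=.
  rewrite /S (@big_cat_nat _ _ _ K 0 n _ (fun k => k%:R * x ^+ k)) //= addrAC subrr add0r.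
  rewrite mulr_sumr -[leLHS]add0r lerD //.
    by rewrite sumr_ge0 // => k _; exact: sqdiff_exp_ge0.
  by rewrite ler_sum_nat // => k /andP[Kk _]; exact: term.
have cS : (s ^+ 2 * A * (S n - S K))%:E @[n --> \oo] -->
    (s ^+ 2 * A * (x / (1 - x) ^+ 2 - S K))%:E.
  apply: cvg_EFin; first exact: nearW.
  apply: cvgMr; apply: cvgB; last exact: cvg_cst.
  exact: cvg_sum_natr_geometric.
have /andP[y_le _] := expR_quotient_bounds _ _ y0.
apply: (@le_trans _ _ (s ^+ 2 * A * (x / (1 - x) ^+ 2 - S K))%:E).
  rewrite lee_fin mulrBr lerB //.
    apply: (@le_trans _ _ (s ^+ 2 * A * (expR (- (c * s)) / (c * s) ^+ 2))).
      rewrite le_eqVlt; apply/orP; left; apply/eqP.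
      by rewrite -/c mulrN [s * c]mulrC; field; rewrite !gt_eqF.
    exact: ler_wpM2l.
  exact: ler_wpM2l.
rewrite -(cvg_lim _ cS) //; apply: lime_le; first by apply/cvg_ex; eexists; exact: cS.
by exists K => // n /= Kn; exact: partial.
Qed.

(** * Behaviour as [s] tends to 0 from the right *)

Lemma near_deviation_le (R : realType) (t : nat -> R) (a eta B : R) :
  0 < a -> 0 < eta ->
  (\forall k \near \oo, (t k - a * k%:R) ^+ 2 <= B * k%:R) ->
  \forall k \near \oo, `|t k - a * k%:R| <= eta * (a * k%:R).
Proof.
move=> a0 eta0 tB; near=> k.
have ea : 0 < (eta * a) ^+ 2 by rewrite exprn_gt0 // mulr_gt0.
have rhs0 : 0 <= eta * (a * k%:R) by rewrite !mulr_ge0 // ltW.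
rewrite -(@ler_pXn2r _ 2) // ?nnegrE //.
rewrite real_normK ?num_real //.
(* From this threshold on, [B k <= (eta a k)^2]. *)
have k_ge : B / (eta * a) ^+ 2 <= k%:R by near: k; exact: nbhs_infty_ger.
apply: (@le_trans _ _ (B * k%:R)); first by near: k.
rewrite mulrA exprMn [k%:R ^+ 2]expr2 mulrA; apply: ler_wpM2r => //.
by rewrite mulrC -ler_pdivrMr.
Unshelve. all: by end_near. Qed.

Lemma cvg_expR_mulr_at0 (R : realType) (c : R) :
  expR (s * c) @[s --> 0^'+] --> (1 : R).
Proof.
apply: cvg_at_right_filter; rewrite -expR0.
apply: continuous_cvg; first exact: continuous_expR.
by rewrite -[X in _ --> X](mul0r c); apply: cvgMl; exact: cvg_id.
Qed.

Lemma cvg_sum_sqdiff_exp (R : realType) (t : nat -> R) (a : R) (K : nat) :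
  \sum_(0 <= k < K) sqdiff_exp t a s k @[s --> 0^'+] --> (0 : R).
Proof.
elim: K => [|K IH].
  rewrite (_ : (fun s => _) = cst 0); first exact: cvg_cst.
  by apply/funext => s; rewrite big_geq.
rewrite (_ : (fun s => _) = (fun s =>
    \sum_(0 <= k < K) sqdiff_exp t a s k + sqdiff_exp t a s K)); last first.
  by apply/funext => s; rewrite big_nat_recr.
rewrite -[X in _ --> X](addr0 0); apply: cvgD => //.
rewrite [X in _ --> X](_ : 0 = (1 - 1) * (1 - 1)); last by rewrite subrr mulr0.
have c1 : expR (- (s * t K)) - expR (- (s * (a * K%:R))) @[s --> 0^'+] -->
    (1 - 1 : R).
  apply: cvgB; under eq_fun do rewrite -mulrN; exact: cvg_expR_mulr_at0.
exact: cvgM.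
Qed.

Lemma near_expsum_le (R : realType) (t : nat -> R) (a B M : R) :
  0 < a -> 0 <= B ->
  (\forall k \near \oo, (t k - a * k%:R) ^+ 2 <= B * k%:R) ->
  B / (4 * a ^+ 2) < M ->
  \forall s \near 0^'+, (expsum t a s <= M%:E)%E.
Proof.
move=> a0 B0 tB BM.
(* The choices are made in the order [eta], [K], [s]. As [eta] tends to 0 the constant tends to
   [B / (4 a^2) < M], so some [eta] keeps it below [M]. *)
have [eta /andP[eta0 eta1] etaM] : exists2 eta : R, 0 < eta < 1 &
    B / (2 * a * (1 - eta)) ^+ 2 < M.
  have : B / (2 * a * (1 - eta)) ^+ 2 @[eta --> 0^'+] -->
      B / (2 * a * (1 - 0)) ^+ 2.
    apply: cvgMr; apply: cvgV.
      by rewrite subr0 mulr1 expf_neq0 // mulf_neq0 // gt_eqF.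
    apply: cvg_at_right_filter.
    apply: cvgM; apply: cvgMr; apply: cvgB; first [exact: cvg_cst|exact: cvg_id].
  move/cvgr_lt => /(_ M); rewrite subr0 mulr1 exprMn -natrX => /(_ BM) near_eta.
  near (0 : R)^'+ => eta; exists eta; last by near: eta.
  by apply/andP; split; near: eta; [exact: nbhs_right_gt|exact: nbhs_right_lt].
have [K _ hK] := filterI tB (near_deviation_le _ _ _ _ _ a0 eta0 tB).
have cvgU : \sum_(0 <= k < K) sqdiff_exp t a s k +
    B / (2 * a * (1 - eta)) ^+ 2 * expR (s * (2 * a * (1 - eta)))
    @[s --> 0^'+] --> 0 + B / (2 * a * (1 - eta)) ^+ 2 * 1.
  apply: cvgD; first exact: cvg_sum_sqdiff_exp.
  by apply: cvgMr; exact: cvg_expR_mulr_at0.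
rewrite add0r mulr1 in cvgU.
near=> s.
have s0 : 0 < s by near: s; exact: nbhs_right_gt.
apply: (le_trans (expsum_le _ _ _ _ eta B K s0 a0 _ B0 _ _)).
- by rewrite eta0.
- by move=> k Kk; case: (hK k Kk).
- by move=> k Kk; case: (hK k Kk).
rewrite lee_fin ltW //.
by near: s; exact: (cvgr_lt _ cvgU).
Unshelve. all: by end_near. Qed.

Lemma near_expsum_ge (R : realType) (t : nat -> R) (a A B m : R) :
  0 < a -> 0 <= A ->
  (\forall k \near \oo, A * k%:R <= (t k - a * k%:R) ^+ 2) ->
  (\forall k \near \oo, (t k - a * k%:R) ^+ 2 <= B * k%:R) ->
  m < A / (4 * a ^+ 2) ->
  \forall s \near 0^'+, (m%:E <= expsum t a s)%E.
Proof.
move=> a0 A0 tA tB mA.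
have [eta eta0 etam] : exists2 eta : R, 0 < eta &
    m < A / (2 * a * (1 + eta)) ^+ 2.
  have : A / (2 * a * (1 + eta)) ^+ 2 @[eta --> 0^'+] -->
      A / (2 * a * (1 + 0)) ^+ 2.
    apply: cvgMr; apply: cvgV.
      by rewrite addr0 mulr1 expf_neq0 // mulf_neq0 // gt_eqF.
    apply: cvg_at_right_filter.
    apply: cvgM; apply: cvgMr; apply: cvgD; first [exact: cvg_cst|exact: cvg_id].
  move/cvgr_gt => /(_ m); rewrite addr0 mulr1 exprMn -natrX => /(_ mA) near_eta.
  near (0 : R)^'+ => eta; exists eta; last by near: eta.
  by near: eta; exact: nbhs_right_gt.
(* The upper bound by [B k] is what makes the relative deviation at most [eta]. *)
have [K _ hK] := filterI tA (near_deviation_le _ _ _ _ _ a0 eta0 tB).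
pose c := 2 * a * (1 + eta).
have cvgL : A / c ^+ 2 * expR (s * - c) - s ^+ 2 * (A * \sum_(0 <= k < K) k%:R)
    @[s --> 0^'+] --> A / c ^+ 2 * 1 - 0 * 0 * (A * \sum_(0 <= k < K) k%:R).
  apply: cvgB; first by apply: cvgMr; exact: cvg_expR_mulr_at0.
  by apply: cvgMl; apply: cvg_at_right_filter; exact: (cvgM cvg_id cvg_id).
rewrite !mul0r subr0 mulr1 in cvgL.
near=> s.
have s0 : 0 < s by near: s; exact: nbhs_right_gt.
apply: le_trans (expsum_ge _ _ _ _ eta A K s0 a0 eta0 A0 _ _).
- rewrite lee_fin ltW // -/c -[s ^+ 2 * A * _]mulrA.
  by near: s; exact: (cvgr_gt _ cvgL).
- by move=> k Kk; case: (hK k Kk).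
- by move=> k Kk; case: (hK k Kk).
Unshelve. all: by end_near. Qed.

(** * The change of variable [s = - ln r] *)

Lemma cvg_oppr_ln_at1 (R : realType) :
  - ln r @[r --> (1 : R)^'-] --> (0 : R)^'+.
Proof.
have c1 : - ln r @[r --> (1 : R)] --> (0 : R).
  by rewrite -[X in _ --> X]oppr0 -(@ln1 R); apply: cvgN; exact: continuous_ln.
move=> P P0.
have {}P0 : \forall x \near (0 : R), 0 < x -> P x by [].
have near1 : \forall r \near (1 : R), 0 < - ln r -> P (- ln r) := c1 _ P0.
change (\forall r \near (1 : R)^'-, P (- ln r)).
near=> r.
(* Continuity of [ln] only gives convergence to 0; the approach is from the right because [ln r < 0]
   for [0 < r < 1]. *)
suff : 0 < - ln r -> P (- ln r).
  apply; rewrite oppr_gt0; apply: ln_lt0; apply/andP; split.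
    by near: r; exact: nbhs_left_gt.
  by near: r; exact: nbhs_left_lt.
near: r; exact: cvg_within.
Unshelve. all: by end_near. Qed.

Lemma Qsum_expsum (R : realType) (t : nat -> R) (N : nat) (r : R) :
  0 < r -> Qsum t N r = expsum t N%:R (- ln r).
Proof.
move=> r0; apply: eq_eseriesr => k _; congr EFin.
(* The natural power is turned into a real one, so that both powers unfold to exponentials of
   multiples of [ln r]. *)
rewrite real_normK ?num_real // -powR_mulrn ?ltW // /powR gt_eqF //.
by rewrite /sqdiff_exp !mulNr !opprK natrM [t k * _]mulrC [in LHS](mulrC (_ * _)).
Qed.

Lemma near_Qsum (R : realType) (t : nat -> R) (N : nat) (P : set \bar R) :
  (\forall s \near 0^'+, P (expsum t N%:R s)) ->
  \forall r \near (1 : R)^'-, P (Qsum t N r).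
Proof.
move=> /(@cvg_oppr_ln_at1 R) nearP; near=> r.
rewrite Qsum_expsum; last by near: r; exact: nbhs_left_gt.
by near: r.
Unshelve. all: by end_near. Qed.

(** * Upper limits along a filter *)

Lemma limf_esup_le_near (T : choiceType) (X : filteredType T) (R : realType)
    (f : X -> \bar R) (F : set_system X) (x : \bar R) :
  (\forall y \near F, (f y <= x)%E) -> (limf_esup f F <= x)%E.
Proof.
move=> fx; apply: le_trans (_ : ereal_sup (f @` [set y | (f y <= x)%E]) <= x)%E.
  (* [limf_esup] is an infimum of suprema over members of [F], and this set is such a member. *)
  by apply: ereal_inf_lbound; exists [set y | (f y <= x)%E].
by apply: ge_ereal_sup => _ [y fyx <-].
Qed.

Lemma near_limf_esup_lt (T : choiceType) (X : filteredType T) (R : realType)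
    (f : X -> \bar R) (F : set_system X) (x : \bar R) : Filter F ->
  (limf_esup f F < x)%E -> \forall y \near F, (f y < x)%E.
Proof.
move=> FF /ereal_inf_lt[_ [A FA <-] Ax].
apply: filterS FA => y Ay; apply: le_lt_trans Ax.
by apply: ereal_sup_ubound; exists y.
Qed.

(** * The bound on [qstar] and the limit of [Qsum] *)

Lemma deviation_sqr (R : realType) (t : nat -> R) (N k : nat) : (0 < k)%N ->
  (t k - N%:R * k%:R) ^+ 2 = deviation t N k ^+ 2 * k%:R.
Proof.
(* At [k = 0] the right side would be 0 and the left side [t_0^2]. *)
move=> k0; have kR : 0 < k%:R :> R by rewrite ltr0n.
rewrite /deviation natrM exprMn exprVn sqr_sqrtr ?ltW //.
by rewrite mulfVK // gt_eqF.
Qed.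

Lemma qstar_le (R : realType) (t : nat -> R) (N : nat) : (0 < N)%N ->
  (Dinfty t N < +oo)%E ->
  (qstar t N <= Dinfty t N ^+ 2 * ((4 * N%:R ^+ 2)^-1)%:E)%E.
Proof.
move=> N0 Doo.
have NR : 0 < N%:R :> R by rewrite ltr0n.
have D0 : (0 <= Dinfty t N)%E.
  apply: limf_esup_ge0; first exact: filter_not_empty.
  by move=> k; rewrite lee_fin divr_ge0 // sqrtr_ge0.
have Dfin : Dinfty t N \is a fin_num by rewrite ge0_fin_numE.
set l := fine (Dinfty t N).
have DE : Dinfty t N = l%:E by rewrite fineK.
have l0 : 0 <= l by rewrite fine_ge0.
rewrite DE -EFin_expe -EFinM.
apply/lee_addgt0Pr => e e0; rewrite -EFinD.
(* The slack [e'] on [l] leaves room for [B = (l + e')^2], since [|t_k - N k| / sqrt k] is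
   eventually below [l + e']. *)
have [e' e'0 e'e] : exists2 e' : R, 0 < e' &
    (l + e') ^+ 2 / (4 * N%:R ^+ 2) < l ^+ 2 / (4 * N%:R ^+ 2) + e.
  have : (l + e') ^+ 2 / (4 * N%:R ^+ 2) @[e' --> 0^'+] -->
      (l + 0) ^+ 2 / (4 * N%:R ^+ 2).
    apply: cvgMl; apply: cvg_at_right_filter.
    by apply: cvgM; apply: cvgD; first [exact: cvg_cst|exact: cvg_id].
  move/cvgr_lt => /(_ (l ^+ 2 / (4 * N%:R ^+ 2) + e)).
  rewrite addr0 ltrDl => /(_ e0) near_e'.
  near (0 : R)^'+ => e'; exists e'; last by near: e'.
  by near: e'; exact: nbhs_right_gt.
apply: limf_esup_le_near; apply: (near_Qsum _ _ _ [set x | (x <= _)%E]).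
apply: (near_expsum_le _ _ _ _ _ NR (sqr_ge0 (l + e')) _ e'e).
have : (Dinfty t N < (l + e')%:E)%E by rewrite DE lte_fin ltrDl.
move/near_limf_esup_lt => dev_lt.
near=> k.
have k0 : (0 < k)%N by near: k; exact: nbhs_infty_gt.
rewrite deviation_sqr //; apply: ler_wpM2r => //.
rewrite -real_normK ?num_real // ler_pXn2r ?nnegrE ?addr_ge0 // ?(ltW e'0) //.
rewrite normrM normfV [`|Num.sqrt _|]ger0_norm ?sqrtr_ge0 //.
by rewrite -lee_fin ltW //; near: k.
Unshelve. all: by end_near. Qed.

Lemma cvg_Qsum (R : realType) (t : nat -> R) (N : nat) (d : R) : (0 < N)%N ->
  deviation t N k @[k --> \oo] --> d ->
  Qsum t N r @[r --> (1 : R)^'-] --> (d ^+ 2 / (4 * N%:R ^+ 2))%:E.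
Proof.
move=> N0 dev_d.
have NR : 0 < N%:R :> R by rewrite ltr0n.
set c := d ^+ 2 / _.
have Q_between e : 0 < e -> \forall r \near (1 : R)^'-,
    ((c - e)%:E <= Qsum t N r <= (c + e)%:E)%E.
  move=> e0.
  (* Scaled so that an error [e'] in [d^2] moves the limit by [e / 2], which gives the strict
     inequalities required below. *)
  pose e' := e * (2 * N%:R ^+ 2).
  have e'0 : 0 < e' by rewrite !mulr_gt0 ?exprn_gt0.
  have e'E : e' / (4 * N%:R ^+ 2) = e / 2 by rewrite /e'; field; rewrite gt_eqF.
  have dev2 : deviation t N k * deviation t N k @[k --> \oo] --> d * d.
    exact: cvgM.
  have tB : \forall k \near \oo,
      (t k - N%:R * k%:R) ^+ 2 <= (d ^+ 2 + e') * k%:R.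
    near=> k; rewrite deviation_sqr; last by near: k; exact: nbhs_infty_gt.
    apply: ler_wpM2r => //; rewrite ltW //.
    by near: k; apply: (cvgr_lt _ dev2); rewrite ltrDl.
  (* The maximum with 0 keeps the lower constant nonnegative when [d^2 < e']. *)
  have tA : \forall k \near \oo,
      Num.max 0 (d ^+ 2 - e') * k%:R <= (t k - N%:R * k%:R) ^+ 2.
    near=> k; rewrite deviation_sqr; last by near: k; exact: nbhs_infty_gt.
    apply: ler_wpM2r => //; rewrite ge_max sqr_ge0 /= ltW //.
    by near: k; apply: (cvgr_gt _ dev2); rewrite gtrBl.
  apply: filterS2 (near_Qsum _ _ _ [set x | ((c - e)%:E <= x)%E] _)
      (near_Qsum _ _ _ [set x | (x <= (c + e)%:E)%E] _).
  - by move=> r /= -> ->.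
  - apply: (near_expsum_ge _ _ _ _ _ _ NR _ tA tB); first by rewrite le_max lexx.
    apply: (@lt_le_trans _ _ ((d ^+ 2 - e') / (4 * N%:R ^+ 2))).
      by rewrite mulrBl e'E -/c; lra.
    by rewrite ler_wpM2r ?le_max ?lexx ?orbT // invr_ge0 mulr_ge0 // sqr_ge0.
  - apply: (near_expsum_le _ _ _ _ _ NR _ tB).
      by rewrite addr_ge0 ?sqr_ge0 // ltW.
    by rewrite mulrDl e'E -/c; lra.
(* Finiteness near 1 reduces convergence in the extended reals to a real epsilon estimate. *)
have Q_fin : \forall r \near (1 : R)^'-, Qsum t N r \is a fin_num.
  apply: filterS (Q_between 1 ltr01) => r /andP[Q_ge Q_le].
  by rewrite fin_real // (lt_le_trans _ Q_ge) ?ltNyr // (le_lt_trans Q_le) ?ltry.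
apply/fine_cvgP; split => //.
apply/cvgrPdist_le => e e0.
apply: filterS2 Q_fin (Q_between e e0) => r Qr.
rewrite /= -(fineK Qr) !lee_fin /= => /andP[Q_ge Q_le].
by rewrite distrC ler_distl Q_ge.
Unshelve. all: by end_near. Qed.

Theorem theorem5p7 (R : realType) (N : nat) (T : set R) (t : nat -> R)
    (N_gt0 : (0 < N)%N)
    (T_ge0 : T `<=` [set x | 0 <= x])
    (T_infinite : infinite_set T)
    (T_lf : locally_finite_set T)
    (t_enum : increasing_enumeration T t) :
  ((Dinfty t N < +oo)%E ->
     (qstar t N <= Dinfty t N ^+ 2 * ((4 * N%:R ^+ 2)^-1)%:E)%E) /\
  (forall d : R,
     deviation t N k @[k --> \oo] --> d ->
     Qsum t N r @[r --> (1 : R)^'-] --> (d ^+ 2 / (4 * N%:R ^+ 2))%:E).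
Proof. by split=> [|d]; [exact: qstar_le|exact: cvg_Qsum]. Qed.
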